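(* Let $m\ge1$ and let $b^{(m)}=(m)$ be the one-letter word consisting of the symbol $m$. For all words $u,v$ in the coarse alphabet $\mathcal A_m$, one has $$\Gamma\bigl(v\,b^{(m)}\,u\bigr)\ge \Gamma(v)\,\Gamma(u).$$
   Context: Let $\mathcal A_m:=\{0,1,\dots,m,\partial\}$, where $\partial$ is an extra symbol. Let $\Sigma_m:=\{(i,j):0\le i,j\le m\}$ and consider the real vector space with basis $\{e_{(i,j)}:(i,j)\in\Sigma_m\}$. For $a\in\{0,\dots,m\}$ define the linear map $M(a)$ by $M(a)e_{(i,j)}:=\mathbf 1_{\{i\ge1\}}e_{(i-1,a)}+\mathbf 1_{\{j\ge1\}}e_{(j-1,a)}$, and set $M(\partial):=0$. For a word $w=(a_1,\dots,a_\ell)$ over $\mathcal A_m$, read from left to right, $M(w):=M(a_\ell)\cdots M(a_1)$. Let $s_i:=(i,m)$ for $i=0,\dots,m-1$, $F_m:=\operatorname{span}\{e_{s_i}:0\le i\le m-1\}$, let $P_F$ be the coordinate projection onto $F_m$ (keeping the coordinates $e_{s_i}$ and killing all others), $\mathbf 1_F$ the vector on $F_m$ with all coordinates equal to one in the basis $(e_{s_i})$, and $e_\star:=e_{(m-1,m)}$. Define $\Gamma(w):=\mathbf 1_F^\top P_FM(w)e_\star$. Juxtaposition of words denotes concatenation. *)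

(* Defs.v *)
From HB Require Import structures.
From mathcomp Require Import all_boot all_order all_algebra reals.

Set Implicit Arguments.
Unset Strict Implicit.
Unset Printing Implicit Defensive.

Import Order.TTheory GRing.Theory Num.Theory.
Local Open Scope ring_scope.

(* [None] is the extra symbol, [Some a] the symbol a in {0, ..., m}. *)
Definition alphabet (m : nat) : Type := option 'I_m.+1.
Definition word (m : nat) : Type := seq (alphabet m).

Definition Sigma (m : nat) : finType := ('I_m.+1 * 'I_m.+1)%type.

(* R^o is R as a module over itself; it makes this type an lmodType R. *)
Definition state_space (R : realType) (m : nat) : lmodType R :=
  {ffun Sigma m -> R^o}.

Definition basis_vec (R : realType) (m : nat) (s : Sigma m) : state_space R m :=
  [ffun t : Sigma m => (t == s)%:R : R^o].

(* The value of M(a) on the basis vector e_(i,j).  [inord i.-1] is i - 1 as an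
   element of 'I_m.+1; it is only relevant when 1 <= i. *)
Definition letter_on_basis (R : realType) (m : nat) (a : 'I_m.+1)
    (s : Sigma m) : state_space R m :=
  (1 <= s.1)%N%:R *: basis_vec R (inord s.1.-1, a)
  + (1 <= s.2)%N%:R *: basis_vec R (inord s.2.-1, a).

Definition letter_map (R : realType) (m : nat) (c : alphabet m)
    (x : state_space R m) : state_space R m :=
  if c is Some a then \sum_(s : Sigma m) (x s : R) *: letter_on_basis R a s
  else 0.

Lemma letter_map_is_linear (R : realType) (m : nat) (c : alphabet m) :
  linear (@letter_map R m c).
Proof.
case: c => [a|] k x y /=; last by rewrite scaler0 addr0.
rewrite scaler_sumr -big_split; apply: eq_bigr => s _.
by rewrite !ffunE scalerDl scalerA.
Qed.

HB.instance Definition _ (R : realType) (m : nat) (c : alphabet m) :=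
  GRing.isLinear.Build R (state_space R m) (state_space R m) _
    (@letter_map R m c) (letter_map_is_linear c).

Lemma letter_map_basis (R : realType) (m : nat) (a : 'I_m.+1) (s : Sigma m) :
  letter_map (Some a) (basis_vec R s) = letter_on_basis R a s.
Proof.
rewrite /letter_map (bigD1 s) //= big1 => [|t /negPf ts].
  by rewrite ffunE eqxx scale1r addr0.
by rewrite ffunE ts scale0r.
Qed.

(* M(a_l) ... M(a_1): the first letter of the word acts first. *)
Definition word_map (R : realType) (m : nat) (w : word m)
    (x : state_space R m) : state_space R m :=
  foldl (fun y c => letter_map c y) x w.

(* s_i = (i, m) for 0 <= i <= m - 1. *)
Definition s_ (m : nat) (i : 'I_m) : Sigma m :=
  (widen_ord (leqnSn m) i, ord_max).

Definition F_index (m : nat) : {set Sigma m} := [set s_ i | i : 'I_m].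

Definition proj_F (R : realType) (m : nat) (x : state_space R m) :
    state_space R m :=
  [ffun s : Sigma m => if s \in F_index m then x s else 0].

Definition one_F (R : realType) (m : nat) : state_space R m :=
  \sum_(i < m) basis_vec R (s_ i).

(* e_(m-1,m); meaningful for 1 <= m. *)
Definition e_star (R : realType) (m : nat) : state_space R m :=
  basis_vec R (inord m.-1, ord_max).

Definition dot (R : realType) (m : nat) (x y : state_space R m) : R :=
  \sum_(s : Sigma m) (x s : R) * (y s : R).

Definition Gamma (R : realType) (m : nat) (w : word m) : R :=
  dot (one_F R m) (proj_F (word_map w (e_star R m))).

Definition b_word (m : nat) : word m := [:: Some ord_max].

(* Main.v *)
Require Import Defs.
From mathcomp Require Import all_boot all_order all_algebra reals.

Import Order.TTheory GRing.Theory Num.Theory.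
Local Open Scope ring_scope.

(** All maps [M(a)] have nonnegative entries, so [Gamma] is a monotone functional
of the starting vector.  Since [M(m) e_(i,m) >= e_(m-1,m)] for every [i < m],
reading the symbol [m] after [v] dominates [Gamma(v) e_star] coordinatewise, and
it remains to apply [M(u)] to both vectors. *)

Section Positivity.
Variables (R : realType) (m : nat).
Implicit Types (x y : state_space R m) (w : word m) (c : alphabet m).

Lemma dot_one_F_proj_F x : dot (one_F R m) (proj_F x) = \sum_(i < m) x (s_ i).
Proof.
rewrite /dot /one_F.
under eq_bigr => s _ do rewrite sum_ffunE mulr_suml.
rewrite exchange_big /=; apply: eq_bigr => i _.
rewrite (bigD1 (s_ i)) //= big1 => [|t /negPf tsi];
  last by rewrite ffunE tsi mul0r.
by rewrite !ffunE eqxx mul1r addr0 imset_f.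
Qed.

Lemma letter_on_basis_ge0 (a : 'I_m.+1) (s t : Sigma m) :
  0 <= (letter_on_basis R a s t : R).
Proof. by rewrite !ffunE addr_ge0 // mulr_ge0 // ler0n. Qed.

Lemma letter_map_ffunE (a : 'I_m.+1) x t :
  letter_map (Some a) x t = \sum_s (x s : R) * (letter_on_basis R a s t : R).
Proof. by rewrite sum_ffunE; apply: eq_bigr => s _; rewrite !ffunE. Qed.

Lemma letter_map_ge0 c x :
  (forall s, 0 <= (x s : R)) -> forall s, 0 <= (letter_map c x s : R).
Proof.
case: c => [a|] x_ge0 t; last by rewrite ffunE.
rewrite letter_map_ffunE; apply: sumr_ge0 => s _.
by rewrite mulr_ge0 ?letter_on_basis_ge0.
Qed.

Lemma word_map_ge0 w x :
  (forall s, 0 <= (x s : R)) -> forall s, 0 <= (word_map w x s : R).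
Proof.
by elim: w x => [//|c w IHw] x x_ge0; apply/IHw/letter_map_ge0.
Qed.

Lemma word_map_is_linear w : linear (@word_map R m w).
Proof. by elim: w => [//|c w IHw] k x y; rewrite /= linearP IHw. Qed.

(** By linearity the difference of the two sides is the image of [y - k *: x], a vector with
    nonnegative coordinates. *)
Lemma word_map_scale_le w k x y :
    (forall s, k * (x s : R) <= (y s : R)) ->
  forall s, k * (word_map w x s : R) <= (word_map w y s : R).
Proof.
move=> le_kx_y s; have -> : y = k *: x + (y - k *: x).
  by rewrite addrC subrK.
rewrite word_map_is_linear !ffunE lerDl; apply: word_map_ge0 => {}s.
by rewrite !ffunE subr_ge0; apply: le_kx_y.
Qed.

(** The second coordinate of [s_ i] is [m], so the second summand of [letter_on_basis] is exactly
    [e_star]; the first is nonnegative. *)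
Lemma letter_on_basis_max_ge_e_star (i : 'I_m) t :
  (e_star R m t : R) <= (letter_on_basis R ord_max (s_ i) t : R).
Proof.
have m_gt0 : (1 <= m)%N := leq_ltn_trans (leq0n i) (ltn_ord i).
by rewrite !ffunE /= m_gt0 scale1r lerDr mulr_ge0 // ler0n.
Qed.

Lemma letter_map_max_ge x : (forall s, 0 <= (x s : R)) ->
  forall t, (\sum_(i < m) (x (s_ i) : R)) * (e_star R m t : R)
    <= (letter_map (Some ord_max) x t : R).
Proof.
move=> x_ge0 t; rewrite letter_map_ffunE.
have s_inj : injective (@s_ m) by move=> i j [] /val_inj.
(* Only the states [s_ i] are needed to reach the bound; the other states contribute a nonnegative
   amount. *)
rewrite (bigID [in F_index m]) /= /F_index big_imset /=;
  last by move=> i j _ _ /s_inj.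
rewrite mulr_suml -[leLHS]addr0; apply: lerD; last first.
  by apply: sumr_ge0 => s _; rewrite mulr_ge0 ?letter_on_basis_ge0.
by apply: ler_sum => i _; rewrite ler_wpM2l ?letter_on_basis_max_ge_e_star.
Qed.

End Positivity.

Theorem lemma4p2 (R : realType) (m : nat) (hm : (1 <= m)%N) (u v : word m) :
  Gamma R v * Gamma R u <= Gamma R (v ++ b_word m ++ u).
Proof.
rewrite /Gamma !dot_one_F_proj_F mulr_sumr /word_map !foldl_cat /=.
(* The comparison is made for each coordinate [s_ i] after reading [u], with [k] equal to
   [Gamma R v], [x] to [e_star], and [y] to the vector reached after [v] and the letter [m]. *)
apply: ler_sum => i _; apply: word_map_scale_le => s.
apply: letter_map_max_ge => {}s; apply: word_map_ge0 => {}s.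
by rewrite ffunE ler0n.
Qed.
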